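(* For every real number $C>0$ there exists a function $f_C\in l^1(\mathbb{Z})$ such that $$\mathcal{F}f_C(1)-\mathcal{F}f_C(0)>C,$$ where $\mathcal{F}f_C$ is the discrete frequency function of $f_C$.
   Context: $\mathbb{Z}^+$ denotes the set of non-negative integers (including $0$). $l^1(\mathbb{Z})$ is the space of absolutely summable (real- or complex-valued) functions on $\mathbb{Z}$. For $f\in l^1(\mathbb{Z})$, $n\in\mathbb{Z}$ and $r\in\mathbb{Z}^+$ put $$\mathcal{A}_rf(n):=\frac{1}{2r+1}\sum_{k=-r}^{r}|f(n+k)|,\qquad \mathcal{M}f(n):=\sup_{r\in\mathbb{Z}^+}\mathcal{A}_rf(n),$$ $$E_{f,n}:=\{r\in\mathbb{Z}^+:\ \mathcal{M}f(n)=\mathcal{A}_rf(n)\}.$$ The set $E_{f,n}$ is always non-empty, and the discrete frequency function is $\mathcal{F}f(n):=\inf E_{f,n}$, i.e. the smallest $r\in\mathbb{Z}^+$ for which the supremum defining $\mathcal{M}f(n)$ is attained. *)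

(* Defs.v *)
From mathcomp Require Import all_boot all_order all_algebra.
From mathcomp Require Import all_classical all_reals all_analysis.

Set Implicit Arguments.
Unset Strict Implicit.
Unset Printing Implicit Defensive.

Import Order.TTheory GRing.Theory Num.Theory.

Local Open Scope classical_set_scope.
Local Open Scope ring_scope.

(* Real-valued functions on the integers; the radii r range over nat. *)

Definition in_l1 (R : realType) (f : int -> R) : Prop :=
  summable [set: int] (fun k => (f k)%:E).

(* The shift k in [-r, r] is written k = i - r with 0 <= i < 2r + 1. *)
Definition avg (R : realType) (r : nat) (f : int -> R) (n : int) : R :=
  ((2 * r).+1)%N%:R^-1 * \sum_(i < ((2 * r).+1)%N) `|f (n + (i%:Z - r%:Z))|.

(* For f in l^1 the set of averages is bounded, so this real supremum is the
   genuine one (sup is 0 by convention on unbounded sets). *)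
Definition maxfun (R : realType) (f : int -> R) (n : int) : R :=
  sup [set avg r f n | r in [set: nat]].

Definition attained (R : realType) (f : int -> R) (n : int) : set nat :=
  [set r | maxfun f n = avg r f n].

(* The infimum is taken in R, so that differences of frequencies are not
   truncated; for f in l^1 the set is nonempty and this is its least element. *)
Definition freqfun (R : realType) (f : int -> R) (n : int) : R :=
  inf [set r%:R | r in attained f n].

(* Main.v *)
Require Import Defs.
From mathcomp Require Import all_boot all_order all_algebra.
From mathcomp Require Import all_classical all_reals all_analysis.
From mathcomp Require Import zify lra.

Import Order.TTheory GRing.Theory Num.Theory.

Local Open Scope ring_scope.

(** Put mass 1 at 0 and mass N at N + 1. Seen from 0 the radius 0 already
    gives the average 1, and the far mass enters only at radius N + 1, with
    average (N + 1) / (2 N + 3) < 1. Seen from 1 the near mass contributes at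
    most 1 / 3, while at radius N the far mass raises the average to
    (N + 1) / (2 N + 1) > 1 / 2. So the frequencies are 0 at 0 and N at 1. *)

(** A strict maximiser makes the supremum a maximum and is the only radius attaining it, so the
    infimum runs over a singleton. *)
Lemma freqfun_strict_max (R : realType) (f : int -> R) (n : int) (r0 : nat) :
  (forall r, r != r0 -> avg r f n < avg r0 f n) -> freqfun f n = r0%:R.
Proof.
move=> ltr0; have maxE : maxfun f n = avg r0 f n.
  apply/eqP; rewrite eq_le; apply/andP; split.
    apply: ge_sup; first by exists (avg r0 f n), r0.
    by move=> _ [r _ <-]; have [->//|/ltr0/ltW] := eqVneq r r0.
  apply: ub_le_sup; last by exists r0.
  by exists (avg r0 f n) => _ [r _ <-]; have [->//|/ltr0/ltW] := eqVneq r r0.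
rewrite /freqfun (_ : attained f n = [set r0]%classic) ?image_set1 ?inf1//.
apply/seteqP; rewrite /attained maxE; split => [r /=|_ /= ->//].
by move=> eqr; apply/eqP; apply/negPn/negP => /ltr0; rewrite eqr ltxx.
Qed.

(** Only the index [i = p - n + r] can hit [p], and it lies in [[0, 2r]] exactly when [p] is within
    distance [r] of [n]. *)
Lemma sum_window_indicator (R : realType) (n p : int) (r : nat) :
  \sum_(i < (2 * r).+1) ((n + (i%:Z - r%:Z) == p)%:R : R) = (`|p - n| <= r)%N%:R.
Proof.
have [le_r|gt_r] := leqP `|p - n|%N r; last first.
  rewrite big1// => i _; have := ltn_ord i.
  by case: eqVneq => // eq_p lt_i; exfalso; lia.
have lt_i : (`|(p - n + r%:Z)%R| < (2 * r).+1)%N by lia.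
rewrite (bigD1 (Ordinal lt_i))//= big1 ?addr0.
  by case: eqVneq => //; lia.
move=> i; rewrite -val_eqE /= => neq_i.
by case: eqVneq => // eq_p; exfalso; lia.
Qed.

Definition two_masses (R : realType) (a b : R) (p q k : int) : R :=
  a * (k == p)%:R + b * (k == q)%:R.

Lemma in_l1_two_masses (R : realType) (a b : R) (p q : int) :
  in_l1 (two_masses R a b p q).
Proof.
have mass (c : R) s : summable [set: int] (fun k => (c * (k == s)%:R)%:E).
  rewrite /summable.
  rewrite (eq_esum (b := fun k => if k \in [set s]%classic then `|c|%:E else 0%E)).
    by rewrite -esum_mkcond esum_set1 ?lee_fin// ltry.
  move=> k _; rewrite classical_sets.in_set1; case: eqP => _ /=.
    by rewrite mulr1.
  by rewrite mulr0 normr0.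
exact: summableD (mass a p) (mass b q).
Qed.

Lemma avg_two_masses (R : realType) (a b : R) (p q n : int) (r : nat) :
  0 <= a -> 0 <= b ->
  avg r (two_masses R a b p q) n =
  (a * (`|p - n| <= r)%N%:R + b * (`|q - n| <= r)%N%:R) / (2 * r).+1%:R.
Proof.
move=> a0 b0; rewrite /avg mulrC -!(sum_window_indicator R) !mulr_sumr -big_split.
congr (_ / _); apply: eq_bigr => i _.
by rewrite ger0_norm// addr_ge0// mulr_ge0// ler0n.
Qed.

Theorem mainTheorem4 (R : realType) (C : R) (hC : 0 < C) :
  exists fC : int -> R, in_l1 fC /\ C < freqfun fC 1 - freqfun fC 0.
Proof.
have [N ltCN N1] : exists2 N : nat, C < N%:R & 1 <= N%:R :> R.
  (* The bound [1 <= N] puts the near mass inside the window of radius [N] around 1. *)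
  by exists (Num.truncn C).+1; [exact: truncnS_gt | rewrite ler1n].
have oddE m : (2 * m).+1%:R = 2 * m%:R + 1 :> R by rewrite -natr1 natrM.
exists (two_masses R 1 N%:R 0 N.+1%:Z); split; first exact: in_l1_two_masses.
have -> : freqfun (two_masses R 1 N%:R 0 N.+1%:Z) 0 = 0%:R.
  apply: freqfun_strict_max => r r0; rewrite !avg_two_masses//.
  rewrite !ltr_pdivrMr ?ltr0n// muln0 divr1.
  have -> : (`|(0 - 0 : int)| <= r)%N by lia.
  have -> : (`|(0 - 0 : int)| <= 0)%N by lia.
  have -> : `|(N.+1%:Z - 0)%R|%N = N.+1 by lia.
  have : (1 <= r)%N by lia.
  rewrite -(ler_nat R) oddE ltn0 mulr1n mulr0n !mulr0 !addr0 !mulr1 mul1r.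
  (* If the window reaches the far mass, then [r >= N + 1] and the total [N + 1] is below [2r + 1];
     otherwise the average is [1 / (2r + 1) < 1]. *)
  case: ltnP => [|_]; rewrite ?mulr1n ?mulr0n; last by lra.
  by rewrite -(ler_nat R) -(natr1 N); lra.
have -> : freqfun (two_masses R 1 N%:R 0 N.+1%:Z) 1 = N%:R.
  apply: freqfun_strict_max => r rN; rewrite !avg_two_masses//.
  have N0 : (0 < N)%N by rewrite -(ler1n R).
  have -> : `|(0 - 1 : int)|%N = 1%N by lia.
  have -> : `|(N.+1%:Z - 1)%R|%N = N by lia.
  rewrite ltr_pdivrMr ?ltr0n// mulrAC ltr_pdivlMr ?ltr0n//.
  rewrite !oddE N0 leqnn !mulr1n !mulr1.
  (* For [r > N] the same total is spread over a longer window. For [r < N] the far mass is not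
     seen: the average is 0 at [r = 0] and [1 / (2r + 1)] from [r = 1] on. *)
  case: (ltngtP N r) rN => // [ltNr|ltrN] _; rewrite ?mulr1n ?mulr0n ?mulr1 ?mulr0.
    rewrite (ltn_trans N0 ltNr) mulr1n.
    by move: ltNr; rewrite -(ltr_nat R); nra.
  rewrite addr0 mul1r; case: posnP => [->|]; rewrite ?mulr1n ?mulr0n ?mulr0.
    by lra.
  by rewrite -(ler_nat R); nra.
by rewrite subr0.
Qed.
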